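(* Let $\mathcal R$ be the synchronous full-information system described in the context. Let $A\subseteq\mathbb V$ be a set of nodes with $\langle i_k,t_k\rangle\in A$ being its latest node (i.e. $t_k\ge t_h$ for all $\langle i_h,t_h\rangle\in A$), and let $r\in\mathcal R$. Assume that $e_{\mathsf s}$ is an external input event that occurs at node $\alpha_0$ in $r$. If $$(\mathcal R,r)\vDash C_A\,\mathsf{occurred}_{t_k}(e_{\mathsf s}),$$ then there is an uneven broom $\hat\theta$ for $\langle\alpha_0,A\rangle$ in $r$.
   Context: Model. $\mathbb P=\{1,\dots,n\}$ is a finite set of agents; time ranges over $\mathbb N$. A node is a pair $\langle i,t\rangle$ with $i\in\mathbb P$ and $t$ a time; $\mathbb V$ is the set of all nodes. The network is a fixed (commonly known) directed graph on $\mathbb P$ in which each channel $(i,j)$ carries a weight $max_{ij}$ (a positive integer), the upper bound on transmission time. A run $r$ is a function from times to global states; $r_i(t)$ is agent $i$'s local state at time $t$ in $r$. $\mathcal R$ is the set of all runs arising when the agents follow the full-information protocol in the following synchronous environment. (1) The environment nondeterministically chooses, at each time, an arbitrary (possibly empty) set of agents at which external input events occur and which external inputs occur there; this choice is unconstrained by other occurrences. An individual external input event is associated with a specific agent and occurs at a single node, i.e. at most once in a run. (2) Each agent has a fixed initial state and perfect recall: $r_i(t)$ is the complete time-stamped history of $i$ up to and including time $t$, including the external inputs and messages (with their senders) received at nodes $\langle i,t'\rangle$ with $t'\le t$. (3) At every node $\langle i,t\rangle$, agent $i$ sends a message containing $r_i(t)$ on every outgoing channel; any further local actions at $\langle i,t\rangle$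 are a deterministic function of $r_i(t)$. (4) A message sent at $\langle i,t\rangle$ on channel $(i,j)$ is delivered at some $\langle j,t'\rangle$ with $t<t'\le t+max_{ij}$; the environment chooses delivery times nondeterministically and arbitrarily within this bound. Semantics. $(\mathcal R,r)\vDash\mathsf{occurred}_t(e)$ iff event $e$ has occurred in $r$ by time $t$. $(\mathcal R,r)\vDash K_{\langle i,t\rangle}\varphi$ iff $(\mathcal R,r')\vDash\varphi$ for all $r'\in\mathcal R$ with $r_i(t)=r'_i(t)$. $(\mathcal R,r)\vDash E_A\varphi$ iff $(\mathcal R,r)\vDash K_\alpha\varphi$ for every $\alpha\in A$. $(\mathcal R,r)\vDash C_A\varphi$ iff $(\mathcal R,r)\vDash (E_A)^m\varphi$ for every $m\ge1$. Potential causality in $r$: $\rightsquigarrow$ is the smallest relation on nodes such that (i) $\langle i,t\rangle\rightsquigarrow\langle i,t'\rangle$ if $t\le t'$; (ii) $\langle i,t\rangle\rightsquigarrow\langle j,t'\rangle$ if some message is sent at $\langle i,t\rangle$ and received at $\langle j,t'\rangle$ in $r$; (iii) it is transitive. Bound guarantee: $\dashrightarrow$ is the smallest relation on nodes such that (i) $\langle i,t\rangle\dashrightarrow\langle i,t'\rangle$ if $t\le t'$; (ii) $\langle i,t\rangle\dashrightarrow\langle j,t+max_{ij}\rangle$ for every channel $(i,j)$; (iii) it is transitive. Uneven broom: a node $\theta$ is an uneven broom for $\langle\alpha_0,A\rangle$ in $r$ if $\alpha_0\rightsquigarrow\theta$ in $r$ and $\theta\dashrightarrow\alpha$ for all $\alpha\in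 A$. *)

(* Defs.v *)
(* MathComp, with [set] from MathComp-Analysis' classical layer. *)
From Stdlib Require List.
From mathcomp Require Import all_boot.
From mathcomp Require Import boolp classical_sets.

Set Implicit Arguments.
Unset Strict Implicit.
Unset Printing Implicit Defensive.

(* Local states over agents 'I_n, external events E and initial states S0.
   [LState s0 h] is the initial state s0 followed by the history h, whose entry
   at position t' is what the agent received at time t': the set of external
   inputs, and the messages tagged with their senders.  The content of a message
   is the local state of its sender at the sending node, so the sending time is
   recoverable as the length of its history minus one. *)
Inductive lstate (n : nat) (E S0 : Type) : Type :=
  LState of S0 & seq (set E * seq ('I_n * lstate n E S0)).

Record context (n : nat) := Context {
  channel : rel 'I_n;
  max_delay : 'I_n -> 'I_n -> nat;
  max_delay_gt0 : forall i j, channel i j -> 0 < max_delay i j;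
  event : Type;
  owner : event -> 'I_n;
  init_type : Type;
  init : 'I_n -> init_type;
  action : Type;
  protocol : 'I_n -> lstate n event init_type -> action
}.

Definition node (n : nat) : Type := ('I_n * nat)%type.

Section Runs.
Variables (n : nat) (c : context n).

Definition local_state : Type := lstate n (event c) (init_type c).

Record global_state := GState {
  locals : 'I_n -> local_state;
  actions : 'I_n -> action c
}.

Definition run : Type := nat -> global_state.

Definition state_at (r : run) (v : node n) : local_state := locals (r v.2) v.1.

Definition history (s : local_state) := let: LState _ h := s in h.

(* What is received at node v = <i,t> itself: the last entry of r_i(t). *)
Definition received_at (r : run) (v : node n) :=
  last (set0, [::]) (history (state_at r v)).

Definition occurs_at (r : run) (e : event c) (v : node n) : Prop :=
  (received_at r v).1 e.

Definition message_in (r : run) (u v : node n) : Prop :=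
  List.In (u.1, state_at r u) (received_at r v).2.

(* Nondeterministic choices of the environment: [inputs t i] is the set of
   external inputs at <i,t>, and [delivery i j s] is the time at which the
   message sent at <i,s> on channel (i,j) is delivered (irrelevant if (i,j) is
   not a channel). *)
Record choices := Choices {
  inputs : nat -> 'I_n -> set (event c);
  delivery : 'I_n -> 'I_n -> nat -> nat
}.

Definition legal (w : choices) : Prop :=
  [/\ forall t i e, inputs w t i e -> owner e = i,
      forall t t' i i' e,
        inputs w t i e -> inputs w t' i' e -> (i, t) = (i', t')
    & forall i j s, channel c i j ->
        s < delivery w i j s <= s + max_delay c i j].

(* The messages delivered at <i,t>, listed by sender and then by sending time,
   so that the list is determined by the set of messages delivered there. *)
Definition messages (w : choices) (r : run) (i : 'I_n) (t : nat) :
    seq ('I_n * local_state) :=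
  [seq (j, state_at r (j, s)) | j <- enum 'I_n,
     s <- [seq s <- iota 0 t | channel c j i && (delivery w j i s == t)]].

(* r is the run of the full-information protocol under the choices w.  Since
   [messages w r i t'] refers to r only at times before t', the first equation
   determines all local states by recursion on time. *)
Definition generates (w : choices) (r : run) : Prop :=
  forall t i,
    locals (r t) i = LState (init c i)
      [seq (inputs w t' i, messages w r i t') | t' <- iota 0 t.+1]
    /\ actions (r t) i = protocol i (locals (r t) i).

Definition runs : set run :=
  [set r | exists w, legal w /\ generates w r].

Definition occurred (t : nat) (e : event c) : set run :=
  [set r | exists i t', t' <= t /\ occurs_at r e (i, t')].

Definition knows (R : set run) (v : node n) (phi : set run) : set run :=
  [set r | forall r', R r' -> state_at r v = state_at r' v -> phi r'].

Definition everyone (R : set run) (A : set (node n)) (phi : set run) :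
    set run :=
  [set r | forall v, A v -> knows R v phi r].

Definition common (R : set run) (A : set (node n)) (phi : set run) : set run :=
  [set r | forall m, 1 <= m -> iter m (everyone R A) phi r].

(* Potential causality. *)
Inductive causes (r : run) : node n -> node n -> Prop :=
| causes_local i t t' : t <= t' -> causes r (i, t) (i, t')
| causes_message u v : message_in r u v -> causes r u v
| causes_trans u v w : causes r u v -> causes r v w -> causes r u w.

(* Bound guarantee. *)
Inductive guarantees : node n -> node n -> Prop :=
| guarantees_local i t t' : t <= t' -> guarantees (i, t) (i, t')
| guarantees_channel i j t :
    channel c i j -> guarantees (i, t) (j, t + max_delay c i j)
| guarantees_trans u v w : guarantees u v -> guarantees v w -> guarantees u w.

Definition uneven_broom (r : run) (alpha0 : node n) (A : set (node n))
    (theta : node n) : Prop :=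
  causes r alpha0 theta /\ forall alpha, A alpha -> guarantees theta alpha.

End Runs.

Arguments runs {n} c.

(* Main.v *)
Require Import Defs.
From Stdlib Require List.
From Stdlib Require Import Relation_Operators Operators_Properties.
From mathcomp Require Import all_boot.
From mathcomp Require Import boolp classical_sets.

Set Implicit Arguments.
Unset Strict Implicit.
Unset Printing Implicit Defensive.

(** Fix choices [w] generating [r].  For a set [Q] of nodes closed under causal
    predecessors, let [prune w Q] keep the inputs and deliveries of [w] at nodes
    of [Q], drop all other inputs, and delay all other messages to their bound.
    For every node [a], shrinking [Q] to its intersection with the causal past
    of [a] under [prune w Q] does not change the state at [a].  Hence [C_A]
    survives every such step with [a] in [A].  Since only finitely many nodes
    lie at times up to [t_k], the process reaches a [Q] whose nodes up to [t_k]
    are all in the past of every node of [A].  The event still occurs, so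
    [alpha0] is in [Q]; a latest node [theta] of [Q] caused by [alpha0] is the
    broom, because every causal path from [theta] to a node of [A] has left [Q]
    and consists of maximally delayed messages. *)

Section UnevenBroom.
Variables (n : nat) (c : context n).
Implicit Types (w : choices c) (r : run c) (Q : set (node n)) (u v : node n).

(** * Existence of runs and the form of their states *)

Lemma messages_ext w r r' i t :
  (forall j s, s < t -> channel c j i -> delivery w j i s = t ->
     state_at r (j, s) = state_at r' (j, s)) ->
  messages w r i t = messages w r' i t.
Proof.
move=> eq_r; rewrite /messages; congr flatten; apply: eq_map => j.
apply/eq_in_map => s; rewrite mem_filter mem_iota /= add0n.
by case/andP=> /andP[cji /eqP ds] st; rewrite (eq_r j s).
Qed.

Definition next_state w r t i : local_state c :=
  LState (init c i) [seq (inputs w t' i, messages w r i t') | t' <- iota 0 t.+1].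

(** The state at a time depends on all earlier states, so the run is built in stages:
    [partial_run w t] is final at times below [t] and holds placeholders from [t] on. *)
Fixpoint partial_run w t : run c :=
  if t is t1.+1 then
    fun s => if s == t1 then
      let l := next_state w (partial_run w t1) t1 in
      GState l (fun i => protocol i (l i))
    else partial_run w t1 s
  else fun _ => GState (fun i => LState (init c i) [::])
                       (fun i => protocol i (LState (init c i) [::])).

Lemma partial_run_stable w t s : s < t -> partial_run w t s = partial_run w s.+1 s.
Proof.
elim: t => // t IHt; rewrite ltnS leq_eqVlt => /predU1P[->//|st].
by rewrite [LHS]/= (ltn_eqF st) IHt.
Qed.

Lemma generates_exists w : exists r, generates w r.
Proof.
exists (fun t => partial_run w t.+1 t) => t i /=; rewrite eqxx; split=> //=.
rewrite /next_state; congr LState; apply/eq_in_map => t'.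
rewrite mem_iota add0n ltnS => /= t't; congr pair.
apply: messages_ext => j s st' _ _; rewrite /state_at /=.
by rewrite partial_run_stable //; apply: leq_trans st' t't.
Qed.

Lemma received_atE w r i t : generates w r ->
  received_at r (i, t) = (inputs w t i, messages w r i t).
Proof.
move=> /(_ t i)[e _]; rewrite /received_at /state_at e /history.
by rewrite -addn1 iotaD map_cat last_cat.
Qed.

(** [V] carries no decidable equality, as it stands for messages containing local states; hence
    [List.In]. *)
Lemma In_allpairs (S T : eqType) (V : Type) (f : S -> T -> V) (ys : S -> seq T)
    (xs : seq S) x y :
  x \in xs -> y \in ys x -> List.In (f x y) [seq f x y | x <- xs, y <- ys x].
Proof.
have In_cat (z : V) s1 s2 : List.In z s1 \/ List.In z s2 -> List.In z (s1 ++ s2).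
  by elim: s1 => [[]//|z1 s1 IHs] /= [[->|z_s1]|z_s2]; [left|right|right]; auto.
move=> + y_ys; elim: xs => //= x1 xs IHxs; rewrite inE => /predU1P[<-|x_xs].
  apply: In_cat; left; elim: (ys x) y_ys => //= y1 s IHs.
  by rewrite inE => /predU1P[->|/IHs]; [left|right].
by apply: In_cat; right; apply: IHxs.
Qed.

Lemma message_in_delivery w r u v : legal w -> generates w r ->
  channel c u.1 v.1 -> delivery w u.1 v.1 u.2 = v.2 -> message_in r u v.
Proof.
case: u v => [j s] [i t] [_ _ lw] gen /= cji d.
have st : s < t by rewrite -d; case/andP: (lw j i s cji).
rewrite /message_in (received_atE _ _ gen) /messages /=.
apply: (In_allpairs (fun j s => (j, state_at r (j, s)))).
  by rewrite mem_enum.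
by rewrite mem_filter cji d eqxx mem_iota.
Qed.

(** * Causality read off the choices *)

(** Local moves take exactly one time unit, so that under legal choices every step strictly
    increases time. *)
Definition step w u v :=
  (u.1 = v.1 /\ v.2 = u.2.+1) \/
  (channel c u.1 v.1 /\ delivery w u.1 v.1 u.2 = v.2).

Definition reach w := clos_refl_trans (node n) (step w).

Lemma step_lt w u v : legal w -> step w u v -> u.2 < v.2.
Proof.
by case=> _ _ lw [[_ ->]//|[cuv <-]]; case/andP: (lw _ _ u.2 cuv).
Qed.

Lemma reach_le w u v : legal w -> reach w u v -> u.2 <= v.2.
Proof.
move=> lw; elim=> [x y /(step_lt lw)/ltnW//|//|x y z _ xy _ yz].
exact: leq_trans yz.
Qed.

Lemma reach_local w i t t' : t <= t' -> reach w (i, t) (i, t').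
Proof.
move/subnKC<-; elim: (t' - t) => [|k IHk]; first by rewrite addn0; apply: rt_refl.
by apply: rt_trans IHk _; apply: rt_step; left; rewrite addnS.
Qed.

Lemma reach_causes w r u v : legal w -> generates w r ->
  reach w u v -> causes r u v.
Proof.
move=> lw gen; elim=> [[j s] [i t]|[i t]|x y z _ xy _ yz].
- case=> /= [[-> ->]|[cji d]]; first exact: causes_local.
  exact/causes_message/(message_in_delivery lw gen).
- exact: causes_local.
- exact: causes_trans yz.
Qed.

Definition past_closed w Q := forall u v, step w u v -> Q v -> Q u.

Lemma past_closed_reach w Q u v : past_closed w Q -> reach w u v -> Q v -> Q u.
Proof. by move=> clQ; elim=> [x y /clQ//|//|x y z _ xy _ yz /yz/xy]. Qed.

Lemma past_closed_past w a : past_closed w [set u | reach w u a].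
Proof. by move=> u v uv /= va; apply: rt_trans va; apply: rt_step. Qed.

Lemma past_closed_local w Q i t t' : past_closed w Q -> t <= t' ->
  Q (i, t') -> Q (i, t).
Proof. by move=> clQ tt'; apply: past_closed_reach clQ (reach_local _ _ tt'). Qed.

(** Strong induction on time: a message received in [Q] was sent from [Q]. Deliveries need only
    agree on whether they hit a given node of [Q]; messages arriving elsewhere may be
    rescheduled. *)
Lemma state_at_eq w w' r r' Q :
  legal w -> generates w r -> generates w' r' -> past_closed w Q ->
  (forall i t, Q (i, t) -> inputs w t i = inputs w' t i) ->
  (forall i t j s, Q (i, t) -> channel c j i ->
     (delivery w j i s == t) = (delivery w' j i s == t)) ->
  forall v, Q v -> state_at r v = state_at r' v.
Proof.
move=> lw gen gen' clQ eq_in eq_del [i t]; elim/ltn_ind: t i => t IHt i Qit.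
rewrite /state_at /= (gen t i).1 (gen' t i).1; congr LState.
apply/eq_in_map => t'; rewrite mem_iota add0n ltnS => /= t't.
have Qit' := past_closed_local clQ t't Qit.
rewrite (eq_in _ _ Qit'); congr pair.
transitivity (messages w r' i t').
  apply: messages_ext => j s st' cji d; apply: IHt; first exact: leq_trans t't.
  by apply: clQ Qit'; right.
rewrite /messages; congr flatten; apply: eq_map => j; congr map.
apply: eq_filter => s; case cji: (channel c j i) => //=.
exact: eq_del.
Qed.

(** * Pruning the choices *)

Definition prune w Q : choices c :=
  Choices (fun t i => [set e | Q (i, t) /\ inputs w t i e]%classic)
    (fun j i s => if `[< Q (i, delivery w j i s) >] then delivery w j i s
                  else s + max_delay c j i).

Lemma prune_setT w : prune w setT = w.
Proof.
case: w => inp del; rewrite /prune /=; congr Choices.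
  by apply/funext => t; apply/funext => i; apply/seteqP; split=> e //= [].
by apply/funext => j; apply/funext => i; apply/funext => s; rewrite asboolT.
Qed.

Lemma legal_prune w Q : legal w -> legal (prune w Q).
Proof.
case=> own uniq_in lw; split=> /=.
- by move=> t i e [_ /own].
- by move=> t t' i i' e [_ et] [_ et']; apply: uniq_in et et'.
move=> i j s cij; case: asboolP => _; first exact: lw.
by rewrite leqnn -[X in X < _]addn0 ltn_add2l max_delay_gt0.
Qed.

(** A delayed message cannot arrive in [Q]: its delivery under [w], to the same agent and no later,
    would then lie in [Q] by closure and be kept. *)
Lemma step_prune w Q u v : legal w -> past_closed w Q -> Q v ->
  step (prune w Q) u v <-> step w u v.
Proof.
case: u v => [j s] [i t] [_ _ lw] clQ Qv; rewrite /step /=.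
split=> -[lo|[cji d]]; try by left.
  right; split=> //; move: d; case: asboolP => // nQ st; case: nQ.
  by apply: past_closed_local clQ _ Qv; rewrite -st; case/andP: (lw j i s cji).
by right; split=> //; rewrite d asboolT.
Qed.

Lemma reach_prune w Q u v : legal w -> past_closed w Q -> Q v ->
  reach (prune w Q) u v -> reach w u v.
Proof.
move=> lw clQ + uv.
have clQ' : past_closed (prune w Q) Q.
  by move=> x y xy Qy; apply: (clQ _ y) => //; apply/(step_prune _ lw clQ Qy).
elim: uv => [x y xy Qy|x _|x y z _ xy yz IH Qz].
- by apply: rt_step; apply/(step_prune x lw clQ Qy).
- exact: rt_refl.
- exact: rt_trans (xy (past_closed_reach clQ' yz Qz)) (IH Qz).
Qed.

Lemma step_late w Q u v : step (prune w Q) u v -> ~ Q v -> guarantees c u v.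
Proof.
case: u v => [j s] [i t] [/= [-> ->] _|/= [cji]]; first exact: guarantees_local.
by case: asboolP => [Qd <- //|_ <- _]; apply: guarantees_channel.
Qed.

(** * Shrinking to the past of a node *)

Section Shrink.
Variables (w : choices c) (Q : set (node n)) (a : node n).
Hypotheses (lw : legal w) (clQ : past_closed w Q).

Definition shrink : set (node n) := Q `&` [set u | reach (prune w Q) u a].

Lemma past_closed_shrink : past_closed w shrink.
Proof.
move=> u v uv [Qv va]; split; first exact: clQ Qv.
by apply: rt_trans va; apply: rt_step; apply/(step_prune u lw clQ).
Qed.

Lemma state_at_shrink r r' :
  generates (prune w Q) r -> generates (prune w shrink) r' ->
  state_at r a = state_at r' a.
Proof.
move=> gen gen'; pose P := [set u | reach (prune w Q) u a]%classic.
have clP : past_closed (prune w Q) P by apply: past_closed_past.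
apply: (state_at_eq (legal_prune Q lw) gen gen' clP); last exact: rt_refl.
  move=> i t Pit /=; apply/seteqP; split=> e /=; first by case.
  by case=> -[].
move=> i t j s Pit cji /=.
have [own uniq_in dw] := lw; have /andP[_ dle] := dw j i s cji.
case: (asboolP (Q _)) => Qd; last by rewrite asboolF // => -[].
(* This message is newly delayed. Neither its old nor its new arrival is in [P]: the new one is no
   earlier, and [P] is closed under earlier nodes of an agent. *)
case: asboolP => // nQd; have nPd : ~ P (i, delivery w j i s).
  by move=> Pd; apply: nQd.
apply/eqP/eqP => eq_t; exfalso; apply: nPd; first by rewrite eq_t.
by apply: past_closed_local clP _ Pit; rewrite -eq_t.
Qed.

End Shrink.

(** * From common knowledge to the broom *)

Lemma common_step R A phi r r' v : common R A phi r -> A v -> R r' ->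
  state_at r v = state_at r' v -> common R A phi r'.
Proof. by move=> C Av Rr' e m m_gt0; apply: (C m.+1 isT v Av r' Rr' e). Qed.

Lemma common_true R A phi r v : common R A phi r -> A v -> R r -> phi r.
Proof. by move=> C Av Rr; apply: (C 1 isT v Av r Rr). Qed.

Definition nodes_upto t Q : {set 'I_n * 'I_t.+1} :=
  [set p : 'I_n * 'I_t.+1 | `[< Q (p.1, val p.2) >]]%SET.

Lemma common_broom w Q r (A : set (node n)) a_k t_k e_s alpha0 :
  legal w -> past_closed w Q -> generates (prune w Q) r ->
  A a_k -> (forall a, A a -> a.2 <= t_k) -> inputs w alpha0.2 alpha0.1 e_s ->
  common (runs c) A (occurred t_k e_s) r ->
  exists theta, reach w alpha0 theta /\ forall a, A a -> guarantees c theta a.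
Proof.
move=> lw + + Aak latest e_in; move: {2}_.+1 (ltnSn #|nodes_upto t_k Q|) => m.
elim: m Q r => // m IHm Q r card_m clQ gen C.
have lwQ := legal_prune Q lw.
(* If such a [u] exists, shrinking at [a] removes it, so the node count drops. *)
case: (pselect (exists a u, [/\ A a, Q u, u.2 <= t_k & ~ reach (prune w Q) u a])).
  case=> a [u [Aa Qu u_le nua]].
  have [r' gen'] := generates_exists (prune w (shrink w Q a)).
  apply: (IHm (shrink w Q a) r') => //; last 1 first.
  - apply: (common_step C Aa); last exact: state_at_shrink gen gen'.
    by exists (prune w (shrink w Q a)); split=> //; apply: legal_prune.
  - apply: leq_trans (_ : #|nodes_upto t_k Q| <= m); last by rewrite -ltnS.
    apply: proper_card; apply/properP; split.
      by apply/fintype.subsetP => p; rewrite !inE => -[].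
    have u_lt : u.2 < t_k.+1 by rewrite ltnS.
    by exists (u.1, Ordinal u_lt); rewrite !inE /= -surjective_pairing //; apply/asboolPn => -[].
  - exact: past_closed_shrink.
move=> stable.
have stableP a u : A a -> Q u -> u.2 <= t_k -> reach (prune w Q) u a.
  by move=> Aa Qu u_le; apply: contrapT => nua; apply: stable; exists a, u.
(* Pruned inputs occur only in [Q], and [e_s] occurs at one node only under [w], so [alpha0] lies in
   [Q]. *)
have [i [t [t_le]]] : occurred t_k e_s r.
  by apply: common_true C Aak _; exists (prune w Q).
rewrite /occurs_at (received_atE _ _ gen) /= => -[Qit e_it].
have {i t e_it Qit t_le}[Q0 le0] : Q alpha0 /\ alpha0.2 <= t_k.
  have [_ uniq_in _] := lw; have := uniq_in _ _ _ _ _ e_in e_it.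
  by rewrite -surjective_pairing => ->.
pose P t := `[< exists i, [/\ Q (i, t), t <= t_k & reach (prune w Q) alpha0 (i, t)] >].
have exP : exists t, P t.
  exists alpha0.2; apply/asboolP; exists alpha0.1.
  by rewrite -surjective_pairing; split=> //; apply: rt_refl.
have ubP t : P t -> t <= t_k by case/asboolP=> i [].
case: (ex_maxnP exP ubP) => t /asboolP[i [Qth th_le r_th]] max_t.
exists (i, t); split; first exact: reach_prune r_th.
move=> a Aa; have r_a := stableP a _ Aa Qth th_le.
(* Induction along the path from the broom, last step outermost. By maximality of [t] each later
   node is outside [Q], so the step into it is a bound guarantee. *)
move: (latest a Aa); have := clos_rt_rtn1 _ _ _ _ r_a.
elim=> [_|x y xy /(@clos_rtn1_rt _ _ _ x) thx IH y_le]; first exact: guarantees_local.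
have xy_lt := step_lt lwQ xy.
apply: guarantees_trans (IH (leq_trans (ltnW xy_lt) y_le)) _.
apply: (step_late xy) => Qy.
have /max_t : P y.2.
  apply/asboolP; exists y.1; rewrite -surjective_pairing; split=> //.
  by apply: rt_trans r_th _; apply: rt_trans thx _; apply: rt_step.
by apply/negP; rewrite -ltnNge; apply: leq_ltn_trans (reach_le lwQ thx) xy_lt.
Qed.

End UnevenBroom.

Theorem theorem7 (n : nat) (c : context n)
    (A : set (node n)) (i_k : 'I_n) (t_k : nat)
    (A_k : A (i_k, t_k))
    (latest : forall i_h t_h, A (i_h, t_h) -> t_h <= t_k)
    (r : run c) (r_run : runs c r)
    (e_s : event c) (alpha0 : node n)
    (e_s_occurs : occurs_at r e_s alpha0) :
  common (runs c) A (occurred t_k e_s) r ->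
  exists theta : node n, uneven_broom r alpha0 A theta.
Proof.
move=> C; case: r_run => w [lw gen].
have e_in : inputs w alpha0.2 alpha0.1 e_s.
  by case: alpha0 e_s_occurs => i t; rewrite /occurs_at (received_atE _ _ gen).
(* The descent starts at the set of all nodes, where pruning changes nothing. *)
have clT : past_closed w setT by [].
have genT : generates (prune w setT) r by rewrite prune_setT.
have latest' a : A a -> a.2 <= t_k by case: a => i t; apply: latest.
have [theta [th0 thA]] := common_broom lw clT genT A_k latest' e_in C.
by exists theta; split=> //; apply: reach_causes gen th0.
Qed.
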